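(* Consider the two-task Jacobi problem described in the context, and let $\omega_m=\operatorname{argmin}_{\omega\in\mathbb{R}}\mathbb{E}_{\tau\sim P}[\mathcal{L}_m(\tau;\omega)]$ be the unique minimizer of the expected solution error after $m$ iterations. (1) For any $p\in(0,1)$, $$\lim_{m\to\infty}\omega_m=\frac{1}{\mu_1}.$$ (2) For any $\epsilon>0$ and $p\in(0,1)$, there exists $m_0$ such that for any $m_1$ and $m_2$ satisfying $m_0<m_1<m_2$, $$\mathbb{E}_{\tau\sim P}[\mathcal{L}_\epsilon(\tau;\omega_{m_1})]\le \mathbb{E}_{\tau\sim P}[\mathcal{L}_\epsilon(\tau;\omega_{m_2})].$$ (3) Furthermore, for any $\epsilon>0$ and $M>0$, there exists a task space $(\mathcal{T},P)$ such that for any $m\ge 0$, $$\mathbb{E}_{\tau\sim P}[\mathcal{L}_\epsilon(\tau;\omega_m)]>M.$$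
   Context: Let $A\in\mathbb{R}^{N\times N}$ be the tridiagonal matrix with $2$ on the diagonal and $-1$ on the sub- and superdiagonals (finite-difference discretization of $-d^2/dx^2$ on $[0,1]$ with zero Dirichlet boundary conditions). Its eigenvalues are $2-2\cos\frac{j\pi}{N+1}$, $j=1,\dots,N$, with corresponding eigenvectors $(\sin\frac{j\pi}{N+1},\sin\frac{2j\pi}{N+1},\dots,\sin\frac{Nj\pi}{N+1})^T$. Let $M_J=I-\frac12 A$ be the Jacobi iteration matrix, which has the same eigenvectors. Task space $(\mathcal{T},P)$: $\mathcal{T}=\{\tau_1,\tau_2\}$, where $\tau_i=\{f_i\}$ is the task of solving $Au=f_i$. It is assumed that $f_i=c_i\mu_iv_i$, where $c_i\in\mathbb{R}_{\ge0}$ is a constant and $v_i$ is the eigenvector of $A$ corresponding to the eigenvalue $\mu_i$. It is also assumed that $\mu_1<\mu_2$, which is taken to mean that $\tau_1$ is more difficult than $\tau_2$ for the Jacobi method. The distribution $P$ generates $\tau_1$ with probability $p$ and $\tau_2$ with probability $1-p$. Solver and meta-solver: for the trainable parameter $\omega\in\mathbb{R}$, the initial guess for task $\tau_i$ is $\hat u_i^{(0)}=\omega f_i$. The Jacobi method produces $\hat u_i^{(k+1)}=M_J\hat u_i^{(k)}+\frac12 f_i$, for $k=0,1,2,\dots$. Losses: for an integer $m\ge0$, $\mathcal{L}_m(\tau_i;\omega)=\|\hat u_i^{(m)}-A^{-1}f_i\|^2$ (Euclidean norm). For $\epsilon>0$, $\mathcal{L}_\epsilon(\tau_i;\omega)=\min\{m\in\mathbb{Z}_{\ge0}:\sqrt{\mathcal{L}_m(\tau_i;\omega)}\le\epsilon\}$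 is the number of iterations needed to reach tolerance $\epsilon$. Expectations are $\mathbb{E}_{\tau\sim P}[F(\tau)]=pF(\tau_1)+(1-p)F(\tau_2)$.
   Formalization: In (1), (2), c_1>0 and |1-μ_2/2|<|1-μ_1/2| (τ_1 harder for Jacobi) are assumed: (1) fails if c_1=0<c_2, or for μ=1,3 at N=2 with c_2>0. (3) is for each N≥2; for N=2,3 it assumes only μ_1<μ_2. *)

(* Defs.v *)
From HB Require Import structures.
From mathcomp Require Import all_boot all_order all_algebra.
From mathcomp Require Import all_classical all_reals all_analysis.

Set Implicit Arguments.
Unset Strict Implicit.
Unset Printing Implicit Defensive.

Import Order.TTheory GRing.Theory Num.Theory.
Import numFieldNormedType.Exports.

Local Open Scope classical_set_scope.
Local Open Scope ring_scope.

Section Jacobi.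
Variables (R : realType) (N : nat).

Definition laplace_mx : 'M[R]_N :=
  \matrix_(i, j)
    if i == j then 2
    else if (i.+1 == j :> nat) || (j.+1 == i :> nat) then - 1 else 0.

Definition jacobi_mx : 'M[R]_N := 1%:M - 2^-1 *: laplace_mx.

Definition eigenpair (mu : R) (v : 'cV[R]_N) : Prop :=
  v != 0 /\ laplace_mx *m v = mu *: v.

(* The norm that the analysis library puts on matrices is the max norm, hence
   this explicit squared Euclidean norm. *)
Definition sqnorm2 (u : 'cV[R]_N) : R := \sum_i u i 0 ^+ 2.

Definition jacobi_iterate (f : 'cV[R]_N) (w : R) (k : nat) : 'cV[R]_N :=
  iter k (fun u => jacobi_mx *m u + 2^-1 *: f) (w *: f).

Definition loss (m : nat) (f : 'cV[R]_N) (w : R) : R :=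
  sqnorm2 (jacobi_iterate f w m - invmx laplace_mx *m f).

Definition reaches (eps : R) (f : 'cV[R]_N) (w : R) (m : nat) : Prop :=
  Num.sqrt (loss m f w) <= eps.

(* Least m with [reaches eps f w m]. The default 0 is never used for 0 < eps:
   the Jacobi matrix has spectral radius cos (pi / N.+1) < 1. *)
Definition iteration_count (eps : R) (f : 'cV[R]_N) (w : R) : nat :=
  xget 0%N [set m | reaches eps f w m /\
                    forall k, reaches eps f w k -> (m <= k)%N].

Record task_space := TaskSpace {
  mu1 : R;
  mu2 : R;
  v1 : 'cV[R]_N;
  v2 : 'cV[R]_N;
  c1 : R;
  c2 : R;
  prob1 : R;
  eigenpair1 : eigenpair mu1 v1;
  eigenpair2 : eigenpair mu2 v2;
  mu12 : mu1 < mu2;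
  c1_ge0 : 0 <= c1;
  c2_ge0 : 0 <= c2;
  prob1_in01 : 0 < prob1 < 1
}.

(* Slower asymptotic convergence of the Jacobi method on the first task:
   1 - mu / 2 is the eigenvalue of the Jacobi matrix belonging to mu, and the
   error component along that eigenvector is multiplied by it at each step.
   This does not follow from mu1 < mu2; given mu1 < mu2, it means
   mu1 + mu2 < 4. *)
Definition first_task_harder (T : task_space) : Prop :=
  `|1 - mu2 T / 2| < `|1 - mu1 T / 2|.

Definition f1 (T : task_space) : 'cV[R]_N := (c1 T * mu1 T) *: v1 T.
Definition f2 (T : task_space) : 'cV[R]_N := (c2 T * mu2 T) *: v2 T.

Definition expect (T : task_space) (F : 'cV[R]_N -> R) : R :=
  prob1 T * F (f1 T) + (1 - prob1 T) * F (f2 T).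

Definition expected_loss (T : task_space) (m : nat) (w : R) : R :=
  expect T (fun f => loss m f w).

Definition expected_count (T : task_space) (eps w : R) : R :=
  expect T (fun f => (iteration_count eps f w)%:R).

Definition unique_minimizer (F : R -> R) (w : R) : Prop :=
  forall w', w' != w -> F w < F w'.

Definition omega (T : task_space) (m : nat) : R :=
  xget 0 [set w | forall w', expected_loss T m w <= expected_loss T m w'].

End Jacobi.

(* Main.v *)
(** On an eigenvector with eigenvalue [mu], one Jacobi step multiplies the error
by [1 - mu / 2], and the initial error is proportional to [w mu - 1].  A maximum
principle for the second difference gives [|1 - mu / 2| < 1].  The expected loss
is thus [a_m (w mu1 - 1)^2 + b_m (w mu2 - 1)^2] with [b_m / a_m] geometrically
decreasing, so its minimizer increases to [1 / mu1] and stays above [1 / mu2].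
Eventually the first task needs no iteration, while the initial error on the
second one increases with [m].  For the last part, no guess is good for both
tasks, so large constants force many iterations whatever [w] is; the two modes
must have nonzero Jacobi eigenvalues, whence the choice of the last mode instead
of the second one when [N < 4]. *)

Require Import Defs.
From HB Require Import structures.
From mathcomp Require Import all_boot all_order all_algebra.
From mathcomp Require Import all_classical all_reals all_analysis.
From mathcomp Require Import ring lra.

Set Implicit Arguments.
Unset Strict Implicit.
Unset Printing Implicit Defensive.

Import Order.TTheory GRing.Theory Num.Theory.
Import numFieldNormedType.Exports.
Local Open Scope classical_set_scope.
Local Open Scope ring_scope.

(* Grid points are numbered 0 .. N.+1: entry [i] of [v] sits at point [i.+1],
   and the value is 0 at the two end points (and beyond). *)
Definition dirichlet_ext (R : realType) (N : nat) (v : 'cV[R]_N) (k : nat) : R :=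
  \sum_(j < N | j.+1 == k) v j 0.

Lemma dirichlet_ext0 (R : realType) (N : nat) (v : 'cV[R]_N) :
  dirichlet_ext v 0 = 0.
Proof. by rewrite /dirichlet_ext big_pred0. Qed.

Lemma dirichlet_extS (R : realType) (N : nat) (v : 'cV[R]_N) (i : 'I_N) :
  dirichlet_ext v i.+1 = v i 0.
Proof. by rewrite /dirichlet_ext (big_pred1 i). Qed.

Lemma dirichlet_ext_out (R : realType) (N : nat) (v : 'cV[R]_N) (k : nat) :
  (N < k)%N -> dirichlet_ext v k = 0.
Proof.
move=> ltNk; rewrite /dirichlet_ext big_pred0 // => j.
by apply/negbTE; rewrite neq_ltn (leq_ltn_trans (ltn_ord j) ltNk).
Qed.

Lemma laplace_mulE (R : realType) (N : nat) (v : 'cV[R]_N) (i : 'I_N) :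
  (laplace_mx R N *m v) i 0 =
    2 * dirichlet_ext v i.+1 - dirichlet_ext v i - dirichlet_ext v i.+2.
Proof.
rewrite mxE /dirichlet_ext mulr_sumr !(big_mkcond (fun j : 'I_N => _ == _)) /=.
rewrite -!sumrB; apply: eq_bigr => j _; rewrite mxE !eqSS.
rewrite (eq_sym (val j) i.+1) /= -val_eqE /= (eq_sym (val j) (val i)).
case: (ltngtP i j) => [ltij|ltji|eqij].
- rewrite (gtn_eqF (leqW ltij)) orbF.
  by case: ifP => _; ring.
- rewrite (gtn_eqF (leqW ltji)) /=.
  by case: ifP => _; ring.
- by rewrite eqij gtn_eqF //; ring.
Qed.

Lemma eigenvalue_jacobi_lt1 (R : realType) (N : nat) (mu : R) (v : 'cV[R]_N) :
  eigenpair mu v -> `|1 - mu / 2| < 1.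
Proof.
case=> v0 Av.
have [i0 vi0] : exists i, v i 0 != 0.
  apply/existsP; apply: contra_neqT v0; rewrite negb_exists => /forallP v0.
  by apply/colP => i; rewrite mxE; apply/eqP; rewrite -[_ == _]negbK v0.
pose im := [arg max_(i > i0) `|v i 0|]%O; pose M := `|v im 0|.
have leM i : `|v i 0| <= M.
  by rewrite /M /im; case: arg_maxP => // j _; apply.
have M0 : 0 < M by rewrite (lt_le_trans _ (leM i0)) // normr_gt0.
have leM' k : `|dirichlet_ext v k| <= M.
  case: k => [|k]; first by rewrite dirichlet_ext0 normr0 ltW.
  case: (ltnP k N) => [ltkN|leNk]; last first.
    by rewrite dirichlet_ext_out // normr0 ltW.
  by rewrite -[k]/(val (Ordinal ltkN)) dirichlet_extS.
rewrite ltNge; apply/negP => ge1.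
(* A first grid point where [`|v|] attains its maximum [M] would have a
   neighbour with a strictly smaller value. *)
have ltM k : (k <= N)%N -> `|dirichlet_ext v k| < M.
  elim: k => [_|k IHk ltkN]; first by rewrite dirichlet_ext0 normr0.
  rewrite lt_neqAle leM' andbT; apply/eqP => eqM.
  have := laplace_mulE v (Ordinal ltkN); rewrite Av mxE -dirichlet_extS /= => E.
  have {}E : 2 * ((1 - mu / 2) * dirichlet_ext v k.+1) =
             dirichlet_ext v k + dirichlet_ext v k.+2 by lra.
  have := ler_normD (dirichlet_ext v k) (dirichlet_ext v k.+2).
  rewrite -E !normrM eqM ger0_norm //.
  have := IHk (ltnW ltkN); have := leM' k.+2.
  have : M <= `|1 - mu / 2| * M by rewrite ler_peMl // ltW.
  lra.
by have := ltM im.+1 (ltn_ord im); rewrite dirichlet_extS ltxx.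
Qed.

Lemma eigenvalue_gt0 (R : realType) (N : nat) (mu : R) (v : 'cV[R]_N) :
  eigenpair mu v -> 0 < mu.
Proof. by move=> /eigenvalue_jacobi_lt1; rewrite ltr_norml => /andP[]; lra. Qed.

Lemma laplace_unitmx (R : realType) (N : nat) : laplace_mx R N \in unitmx.
Proof.
rewrite unitmxE unitfE -det_tr; apply/det0P => -[v v0 vA].
have : eigenpair (0 : R) v^T.
  split; first by rewrite -(inj_eq trmx_inj) trmxK trmx0.
  by rewrite scale0r; apply: trmx_inj; rewrite trmx_mul trmxK vA trmx0.
by move=> /eigenvalue_gt0; rewrite ltxx.
Qed.

Lemma jacobi_errorE (R : realType) (N : nat) (mu : R) (v : 'cV[R]_N)
    (c w : R) (k : nat) : eigenpair mu v ->
  jacobi_iterate ((c * mu) *: v) w k -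
    invmx (laplace_mx R N) *m ((c * mu) *: v) =
  (c * (w * mu - 1) * (1 - mu / 2) ^+ k) *: v.
Proof.
case=> _ Av.
have -> : invmx (laplace_mx R N) *m ((c * mu) *: v) = c *: v.
  by rewrite -scalerA -Av -scalemxAr mulKmx // laplace_unitmx.
apply/eqP; rewrite subr_eq -scalerDl; apply/eqP.
rewrite /jacobi_iterate; elim: k => [|k IHk] /=.
  by rewrite scalerA; congr (_ *: _); ring.
rewrite IHk /jacobi_mx mulmxBl mul1mx -scalemxAl -!scalemxAr Av !scalerA.
by rewrite -scalerBl -scalerDl; congr (_ *: _); rewrite exprS; field.
Qed.

Lemma sqnorm2Z (R : realType) (N : nat) (a : R) (v : 'cV[R]_N) :
  sqnorm2 (a *: v) = a ^+ 2 * sqnorm2 v.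
Proof.
by rewrite /sqnorm2 mulr_sumr; apply: eq_bigr => i _; rewrite mxE exprMn.
Qed.

Lemma sqnorm2_gt0 (R : realType) (N : nat) (v : 'cV[R]_N) :
  v != 0 -> 0 < sqnorm2 v.
Proof.
move=> v0; rewrite lt_def sumr_ge0 ?andbT => [|i _]; last exact: sqr_ge0.
apply: contra_neq v0 => /eqP; rewrite psumr_eq0 => [/allP s0|i _]; last first.
  exact: sqr_ge0.
apply/colP => i; rewrite mxE; apply/eqP.
by have := s0 i (mem_index_enum i); rewrite sqrf_eq0.
Qed.

Lemma loss_eigenE (R : realType) (N : nat) (mu : R) (v : 'cV[R]_N)
    (c w : R) (k : nat) : eigenpair mu v ->
  loss k ((c * mu) *: v) w =
    c ^+ 2 * sqnorm2 v * ((1 - mu / 2) ^+ 2) ^+ k * (w * mu - 1) ^+ 2.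
Proof. by move=> ev; rewrite /loss jacobi_errorE // sqnorm2Z exprAC; ring. Qed.

Lemma reaches_eigenE (R : realType) (N : nat) (eps mu : R) (v : 'cV[R]_N)
    (c w : R) (k : nat) : 0 <= c -> eigenpair mu v ->
  reaches eps ((c * mu) *: v) w k =
    (c * Num.sqrt (sqnorm2 v) * `|1 - mu / 2| ^+ k * `|w * mu - 1| <= eps).
Proof.
move=> c0 ev; rewrite /reaches /loss jacobi_errorE // sqnorm2Z.
rewrite sqrtrM ?sqr_ge0 // sqrtr_sqr !normrM normrX (ger0_norm c0).
by congr (is_true (_ <= _)); ring.
Qed.

Lemma ex_reaches_eigen (R : realType) (N : nat) (eps mu : R) (v : 'cV[R]_N)
    (c w : R) : 0 < eps -> 0 <= c -> eigenpair mu v ->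
  exists k, reaches eps ((c * mu) *: v) w k.
Proof.
move=> eps0 c0 ev.
pose C := c * Num.sqrt (sqnorm2 v) * `|w * mu - 1|.
have C0 : 0 <= C by rewrite !mulr_ge0 ?sqrtr_ge0.
have rho1 : `| `|1 - mu / 2| | < 1 by rewrite normr_id (eigenvalue_jacobi_lt1 ev).
have /cvgr0Pnorm_lt/(_ (eps / (C + 1))) := cvg_expr rho1.
have C1 : 0 < C + 1 by rewrite ltr_wpDl.
rewrite divr_gt0 // => /(_ isT) [k _ /(_ k (leqnn k))] /=.
rewrite normrX normr_id ltr_pdivlMr // => H.
exists k; rewrite reaches_eigenE // mulrAC -/C.
have := exprn_ge0 k (normr_ge0 (1 - mu / 2)); nra.
Qed.

Lemma iteration_countP (R : realType) (N : nat) (eps : R) (f : 'cV[R]_N)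
    (w : R) : (exists k, reaches eps f w k) ->
  reaches eps f w (iteration_count eps f w) /\
  forall k, reaches eps f w k -> (iteration_count eps f w <= k)%N.
Proof.
move=> exk; rewrite /iteration_count; case: xgetP => //= nex.
have exk' : exists k, `[< reaches eps f w k >].
  by case: exk => k ?; exists k; apply/asboolP.
case: (ex_minnP exk') => m /asboolP rm mmin; case: (nex m).
by split=> // k ?; apply: mmin; apply/asboolP.
Qed.

Lemma le_iteration_count (R : realType) (N : nat) (eps : R) (f : 'cV[R]_N)
    (w w' : R) : (exists k, reaches eps f w' k) ->
  (forall k, reaches eps f w' k -> reaches eps f w k) ->
  (iteration_count eps f w <= iteration_count eps f w')%N.
Proof.
move=> exk sub; have [r' _] := iteration_countP exk.
have [|_ ->] // := @iteration_countP _ _ eps f w; last exact: sub.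
by case: exk => k ?; exists k; apply: sub.
Qed.

Lemma quadratic_unique_minimizer (R : realType) (a b x y : R) :
  0 < a * x ^+ 2 + b * y ^+ 2 ->
  unique_minimizer (fun w => a * (w * x - 1) ^+ 2 + b * (w * y - 1) ^+ 2)
    ((a * x + b * y) / (a * x ^+ 2 + b * y ^+ 2)).
Proof.
move=> D0 w'; set D := (X in 0 < X) in D0 *; set w := _ / D => ww'.
have wD : w * D = a * x + b * y by rewrite /w divfK // gt_eqF.
rewrite -subr_gt0; have -> : a * (w' * x - 1) ^+ 2 + b * (w' * y - 1) ^+ 2 -
    (a * (w * x - 1) ^+ 2 + b * (w * y - 1) ^+ 2) =
    D * (w' - w) ^+ 2 + 2 * (w' - w) * (w * D - (a * x + b * y)).
  by rewrite /D; ring.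
by rewrite wD subrr mulr0 addr0 mulr_gt0 // exprn_even_gt0 //= subr_eq0.
Qed.

Lemma unique_minimizer_omega (R : realType) (N : nat) (T : task_space R N)
    (m : nat) (w : R) :
  unique_minimizer (expected_loss T m) w -> omega T m = w.
Proof.
move=> minw; rewrite /omega; case: xgetP => [w' _ /= minw'|/(_ w) []] /=.
  apply/eqP; apply: contraT => /minw.
  by rewrite ltNge minw'.
by move=> w'; have [->//|/minw/ltW] := eqVneq w' w.
Qed.

(* [(a x + b y) / (a x^2 + b y^2)] in terms of the weight ratio [t = b / a] *)
Definition weighted_inv (R : realType) (x y t : R) : R :=
  (x + t * y) / (x ^+ 2 + t * y ^+ 2).

Section WeightedInv.
Variables (R : realType) (x y : R).
Hypotheses (x0 : 0 < x) (ltxy : x < y).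

Lemma weighted_inv_denom_gt0 (t : R) : 0 <= t -> 0 < x ^+ 2 + t * y ^+ 2.
Proof. by move=> t0; rewrite ltr_wpDr ?exprn_gt0 // mulr_ge0 ?sqr_ge0. Qed.

Lemma weighted_inv_ge (t : R) : 0 <= t -> 1 <= weighted_inv x y t * y.
Proof.
move=> t0; rewrite /weighted_inv mulrAC ler_pdivlMr ?weighted_inv_denom_gt0 //.
by rewrite mul1r mulrDl mulrAC expr2 expr2 mulrA lerD2r ler_wpM2l ?ltW.
Qed.

Lemma weighted_inv_anti (s t : R) :
  0 <= s -> s <= t -> weighted_inv x y t <= weighted_inv x y s.
Proof.
move=> s0 st; rewrite /weighted_inv.
rewrite ler_pdivrMr ?weighted_inv_denom_gt0 ?(le_trans s0) //.
rewrite mulrAC ler_pdivlMr ?weighted_inv_denom_gt0 // -subr_ge0.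
have -> : (x + s * y) * (x ^+ 2 + t * y ^+ 2) -
  (x + t * y) * (x ^+ 2 + s * y ^+ 2) = (t - s) * (x * y * (y - x)) by ring.
by rewrite !mulr_ge0 ?subr_ge0 ?(ltW ltxy) // ltW // (lt_trans x0).
Qed.

Lemma cvg_weighted_inv (t : nat -> R) :
  t @ \oo --> 0 -> weighted_inv x y \o t @ \oo --> x^-1.
Proof.
move=> t0; have -> : x^-1 = (x + 0 * y) * (x ^+ 2 + 0 * y ^+ 2)^-1.
  by field; rewrite gt_eqF.
apply: cvgM.
  by apply: cvgD; [exact: cvg_cst | apply: cvgMl].
apply: cvgV; first by rewrite mul0r addr0 expf_neq0 // gt_eqF.
by apply: cvgD; [exact: cvg_cst | apply: cvgMl].
Qed.

End WeightedInv.

Definition loss_weight (R : realType) (N : nat) (p c mu : R) (v : 'cV[R]_N)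
    (m : nat) : R :=
  p * (c ^+ 2 * sqnorm2 v * ((1 - mu / 2) ^+ 2) ^+ m).

Section TwoTasks.
Variables (R : realType) (N : nat).
Variable T : task_space R N.
Hypotheses (c1_gt0 : 0 < c1 T) (rho1_neq0 : 1 - mu1 T / 2 != 0).

Let weight1 := loss_weight (prob1 T) (c1 T) (mu1 T) (v1 T).
Let weight2 := loss_weight (1 - prob1 T) (c2 T) (mu2 T) (v2 T).

Lemma expected_lossE (m : nat) (w : R) :
  expected_loss T m w =
  weight1 m * (w * mu1 T - 1) ^+ 2 + weight2 m * (w * mu2 T - 1) ^+ 2.
Proof.
rewrite /expected_loss /expect /f1 /f2 !loss_eigenE; last 2 first.
- exact: eigenpair2.
- exact: eigenpair1.
by rewrite /weight1 /weight2 /loss_weight; ring.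
Qed.

Lemma weight1_gt0 (m : nat) : 0 < weight1 m.
Proof.
have /andP[p0 _] := prob1_in01 T; have [v0 _] := eigenpair1 T.
have r0 : 0 < (1 - mu1 T / 2) ^+ 2 by rewrite exprn_even_gt0.
by rewrite /weight1 /loss_weight !mulr_gt0 ?sqnorm2_gt0 ?(exprn_gt0 m r0).
Qed.

Lemma weight2_ge0 (m : nat) : 0 <= weight2 m.
Proof.
have /andP[_ p1] := prob1_in01 T; have [v0 _] := eigenpair2 T.
have s0 := ltW (sqnorm2_gt0 v0).
have r0 := exprn_ge0 m (sqr_ge0 (1 - mu2 T / 2)).
apply: mulr_ge0; first by rewrite subr_ge0 ltW.
by apply: mulr_ge0 r0; apply: mulr_ge0 s0; exact: sqr_ge0.
Qed.

Let omega_and_minimizer (m : nat) :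
  unique_minimizer (expected_loss T m) (omega T m) /\
  omega T m = weighted_inv (mu1 T) (mu2 T) (weight2 m / weight1 m).
Proof.
have w1 := weight1_gt0 m; have mu0 := eigenvalue_gt0 (eigenpair1 T).
have D0 : 0 < weight1 m * mu1 T ^+ 2 + weight2 m * mu2 T ^+ 2.
  apply: ltr_wpDr (mulr_gt0 w1 (exprn_gt0 2 mu0)).
  exact: mulr_ge0 (weight2_ge0 m) (sqr_ge0 _).
have := quadratic_unique_minimizer D0.
rewrite -(funext (expected_lossE m)) => minw.
rewrite (unique_minimizer_omega minw); split => //.
rewrite /weighted_inv; have w1' := lt0r_neq0 w1.
by field; rewrite w1' (mulrC (mu1 T ^+ 2)) lt0r_neq0.
Qed.

Lemma omega_unique_minimizer (m : nat) :
  unique_minimizer (expected_loss T m) (omega T m).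
Proof. by have [] := omega_and_minimizer m. Qed.

Lemma omegaE (m : nat) :
  omega T m = weighted_inv (mu1 T) (mu2 T) (weight2 m / weight1 m).
Proof. by have [] := omega_and_minimizer m. Qed.

Lemma weight_ratioE (m : nat) :
  weight2 m / weight1 m = weight2 0 / weight1 0 *
    (((1 - mu2 T / 2) / (1 - mu1 T / 2)) ^+ 2) ^+ m.
Proof.
have w1 := lt0r_neq0 (weight1_gt0 0).
have E1 : weight1 m = weight1 0 * ((1 - mu1 T / 2) ^+ 2) ^+ m.
  by rewrite /weight1 /loss_weight expr0; ring.
have E2 : weight2 m = weight2 0 * ((1 - mu2 T / 2) ^+ 2) ^+ m.
  by rewrite /weight2 /loss_weight expr0; ring.
by rewrite E1 E2 expr_div_n expr_div_n invfM mulrACA.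
Qed.

Hypothesis harder : first_task_harder T.

Let q : R := ((1 - mu2 T / 2) / (1 - mu1 T / 2)) ^+ 2.

Let q_lt1 : 0 <= q < 1.
Proof.
rewrite /q sqr_ge0 /= -real_normK ?num_real //.
rewrite expr_lt1 // normrM normfV ltr_pdivrMr ?mul1r //.
by rewrite normr_gt0.
Qed.

Lemma weight_ratio_cvg0 : (fun m => weight2 m / weight1 m) @ \oo --> 0.
Proof.
rewrite (funext weight_ratioE) -(mulr0 (weight2 0 / weight1 0)).
apply: cvgM; first exact: cvg_cst.
apply: cvg_expr; case/andP: q_lt1 => q0 q1.
by rewrite ger0_norm.
Qed.

Lemma weight_ratio_ge0 (m : nat) : 0 <= weight2 m / weight1 m.
Proof. by rewrite divr_ge0 ?weight2_ge0 // ltW // weight1_gt0. Qed.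

Lemma weight_ratio_anti (m n : nat) : (m <= n)%N ->
  weight2 n / weight1 n <= weight2 m / weight1 m.
Proof.
move=> lemn; rewrite (weight_ratioE m) (weight_ratioE n) ler_wpM2l ?weight_ratio_ge0 //.
by case/andP: q_lt1 => q0 q1; rewrite ler_wiXn2l // ltW.
Qed.

Lemma omega_cvg : omega T @ \oo --> (mu1 T)^-1.
Proof.
rewrite (funext omegaE).
apply: cvg_weighted_inv weight_ratio_cvg0.
exact: eigenvalue_gt0 (eigenpair1 T).
Qed.

Lemma expected_count_omega_le (eps : R) : 0 < eps ->
  exists m0 : nat, forall m1 m2 : nat, (m0 < m1)%N -> (m1 < m2)%N ->
    expected_count T eps (omega T m1) <= expected_count T eps (omega T m2).
Proof.
move=> eps0; have mu0 := eigenvalue_gt0 (eigenpair1 T).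
pose C := c1 T * Num.sqrt (sqnorm2 (v1 T)).
have C0 : 0 <= C by rewrite mulr_ge0 ?sqrtr_ge0 ?c1_ge0.
have rel0 : (fun m => omega T m * mu1 T - 1) @ \oo --> (0 : R).
  have -> : 0 = (mu1 T)^-1 * mu1 T - 1 by rewrite mulVf ?subrr ?lt0r_neq0.
  apply: cvgB; last exact: cvg_cst.
  by apply: cvgM; [exact: omega_cvg | exact: cvg_cst].
have err0 : (fun m => C * `|omega T m * mu1 T - 1|) @ \oo --> (0 : R).
  have -> : 0 = C * `|0 : R| by rewrite normr0 mulr0.
  by apply: cvgM; [exact: cvg_cst | exact: cvg_norm].
have /cvgr0Pnorm_le/(_ _ eps0) [m0 _ Hm0] := err0.
have count1 m : (m0 <= m)%N -> iteration_count eps (f1 T) (omega T m) = 0%N.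
  move=> lem; have r0 : reaches eps (f1 T) (omega T m) 0.
    rewrite /f1 reaches_eigenE ?c1_ge0 //; last exact: eigenpair1.
    by rewrite expr0 mulr1; have := Hm0 m lem; rewrite /= ger0_norm // mulr_ge0.
  apply/eqP; rewrite -leqn0.
  by have [_ -> //] := iteration_countP (ex_intro _ _ r0).
exists m0 => m n ltm0m ltmn; rewrite /expected_count /expect.
rewrite (count1 m (ltnW ltm0m)) (count1 n (ltnW (ltn_trans ltm0m ltmn))).
rewrite lerD2l; apply: ler_wpM2l.
  by have /andP[_ /ltW] := prob1_in01 T; rewrite subr_ge0.
rewrite ler_nat; apply: le_iteration_count.
  by apply: ex_reaches_eigen; rewrite ?c2_ge0 //; exact: eigenpair2.
have ev2 := eigenpair2 T; have c2T := c2_ge0 T.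
move=> k; rewrite /f2 !reaches_eigenE //; apply: le_trans.
apply: ler_wpM2l; first by rewrite !mulr_ge0 ?sqrtr_ge0 ?exprn_ge0.
have ge1 j : 1 <= omega T j * mu2 T.
  by rewrite omegaE; apply: weighted_inv_ge; rewrite ?mu12 ?weight_ratio_ge0.
rewrite !ger0_norm ?subr_ge0 // lerB // ler_wpM2r //.
  exact: ltW (eigenvalue_gt0 ev2).
rewrite !omegaE; apply: weighted_inv_anti; rewrite ?mu12 ?weight_ratio_ge0 //.
exact: weight_ratio_anti (ltnW ltmn).
Qed.

End TwoTasks.

Lemma iteration_count_gt (R : realType) (N : nat) (eps mu : R) (v : 'cV[R]_N)
    (c w : R) (K : nat) : 0 < eps -> 0 <= c -> eigenpair mu v ->
  eps < c * Num.sqrt (sqnorm2 v) * `|1 - mu / 2| ^+ K * `|w * mu - 1| ->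
  (K < iteration_count eps ((c * mu) *: v) w)%N.
Proof.
move=> eps0 c0 ev; apply: contraTT; rewrite -leqNgt -leNgt => leK.
have [+ _] := iteration_countP (ex_reaches_eigen w eps0 c0 ev).
rewrite reaches_eigenE //; apply: le_trans.
rewrite ler_wpM2r // ler_wpM2l ?mulr_ge0 ?sqrtr_ge0 //.
by rewrite ler_wiXn2l // ltW // (eigenvalue_jacobi_lt1 ev).
Qed.

Lemma inv_residual_gap (R : realType) (w x y : R) :
  0 < x < 4 -> 0 < y < 4 -> x < y ->
  (y - x <= 8 * `|w * x - 1|) || (y - x <= 8 * `|w * y - 1|).
Proof.
move=> /andP[x0 x4] /andP[y0 y4] xy; rewrite !leNgt -negb_and; apply/negP.
move=> /andP[lt1 lt2].
have := ler_normB (x * (w * y - 1)) (y * (w * x - 1)).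
have -> : x * (w * y - 1) - y * (w * x - 1) = y - x by ring.
rewrite !normrM (gtr0_norm x0) (gtr0_norm y0).
rewrite (@gtr0_norm _ (y - x)) ?subr_gt0 //.
have : x * `|w * y - 1| <= 4 * `|w * y - 1| by rewrite ler_wpM2r // ltW.
have : y * `|w * x - 1| <= 4 * `|w * x - 1| by rewrite ler_wpM2r // ltW.
lra.
Qed.

Lemma ex_expected_count_gt (R : realType) (N : nat) (x y : R)
    (u v : 'cV[R]_N) (eps M : R) :
  eigenpair x u -> eigenpair y v -> x < y ->
  1 - x / 2 != 0 -> 1 - y / 2 != 0 -> 0 < eps ->
  exists T : task_space R N,
    [/\ mu1 T = x, mu2 T = y, 0 < c1 T &
        forall w, M < expected_count T eps w].
Proof.
move=> eu ev xy rx ry eps0.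
have bounds z (t : 'cV[R]_N) : eigenpair z t -> 0 < z < 4.
  by move=> /eigenvalue_jacobi_lt1; rewrite ltr_norml => /andP[? ?]; lra.
pose K := (Num.truncn (2 * M)).+1.
have KM : 2 * M < K%:R by apply: truncnS_gt.
pose e1 := Num.sqrt (sqnorm2 u) * `|1 - x / 2| ^+ K.
pose e2 := Num.sqrt (sqnorm2 v) * `|1 - y / 2| ^+ K.
have e10 : 0 < e1.
  by rewrite mulr_gt0 ?sqrtr_gt0 ?sqnorm2_gt0 ?exprn_gt0 ?normr_gt0 //; case: eu.
have e20 : 0 < e2.
  by rewrite mulr_gt0 ?sqrtr_gt0 ?sqnorm2_gt0 ?exprn_gt0 ?normr_gt0 //; case: ev.
pose E := 8 * eps / (y - x).
have E0 : 0 < E by rewrite divr_gt0 ?mulr_gt0 ?subr_gt0.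
pose c := E * (e1^-1 + e2^-1).
have c0 : 0 < c by rewrite mulr_gt0 // addr_gt0 ?invr_gt0.
have ce1 : E < c * e1.
  have -> : c * e1 = E + E * (e2^-1 * e1) by rewrite /c; field; rewrite !gt_eqF.
  by rewrite ltrDl; apply/mulr_gt0/mulr_gt0 => //; rewrite invr_gt0.
have ce2 : E < c * e2.
  have -> : c * e2 = E + E * (e1^-1 * e2) by rewrite /c; field; rewrite !gt_eqF.
  by rewrite ltrDl; apply/mulr_gt0/mulr_gt0 => //; rewrite invr_gt0.
have half01 : 0 < (2^-1 : R) < 1 by apply/andP; split; lra.
exists (TaskSpace eu ev xy (ltW c0) (ltW c0) half01); split=> // w.
rewrite /expected_count /expect /f1 /f2 /=.
have large a z : E < a -> y - x <= 8 * `|w * z - 1| ->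
    eps < a * `|w * z - 1|.
  move=> Ea gap; rewrite -(ltr_pM2l (ltr0n R 8)).
  have eE : 8 * eps = E * (y - x) by rewrite divfK // subr_eq0 gt_eqF.
  rewrite eE mulrCA; apply: (lt_le_trans (y := a * (y - x))).
    by rewrite ltr_pM2r // subr_gt0.
  by rewrite ler_pM2l // (lt_trans E0).
set n1 := iteration_count _ _ _; set n2 := iteration_count _ _ _.
have half (a b : nat) : (K < a)%N || (K < b)%N ->
    M < 2^-1 * a%:R + (1 - 2^-1) * b%:R.
  rewrite -!(ltr_nat R); move: (ler0n R a) (ler0n R b) KM.
  by move: (K%:R : R) (a%:R : R) (b%:R : R) => k r s ? ? ? /orP[]; lra.
apply: half.
have /orP[gap|gap] := inv_residual_gap w (bounds _ _ eu) (bounds _ _ ev) xy.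
- apply/orP; left; apply: iteration_count_gt (ltW c0) eu _ => //.
  by rewrite -(mulrA c); apply: large.
- apply/orP; right; apply: iteration_count_gt (ltW c0) ev _ => //.
  by rewrite -(mulrA c); apply: large.
Qed.

Definition sine_mode (R : realType) (N : nat) (t : R) : 'cV[R]_N :=
  \col_i sin (i.+1%:R * t).

Lemma dirichlet_ext_sine_mode (R : realType) (N : nat) (t : R) (k : nat) :
  sin (N.+1%:R * t) = 0 -> (k <= N.+1)%N ->
  dirichlet_ext (sine_mode N t) k = sin (k%:R * t).
Proof.
move=> sN; case: k => [|k]; first by rewrite dirichlet_ext0 mul0r sin0.
rewrite ltnS leq_eqVlt => /predU1P[->|ltkN].
  by rewrite dirichlet_ext_out ?sN.
by rewrite -[k]/(val (Ordinal ltkN)) dirichlet_extS mxE.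
Qed.

Lemma sine_mode_eigenpair (R : realType) (N : nat) (t : R) :
  (0 < N)%N -> sin t != 0 -> sin (N.+1%:R * t) = 0 ->
  eigenpair (2 - 2 * cos t) (sine_mode N t).
Proof.
move=> N0 st sN; split.
  apply: contraNneq st => /colP/(_ (Ordinal N0)).
  by rewrite !mxE /= mul1r => ->.
apply/colP => i; rewrite laplace_mulE [RHS]mxE -dirichlet_extS.
have iN := ltn_ord i.
rewrite !dirichlet_ext_sine_mode ?ltnS // ?(ltnW (ltnW iN)) ?(ltnW iN) //.
  2: exact: leqW (ltnW iN).
have -> : i%:R * t = i.+1%:R * t - t by rewrite -natr1; ring.
have -> : i.+2%:R * t = i.+1%:R * t + t by rewrite -(natr1 i.+1); ring.
by rewrite sinB sinD; ring.
Qed.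

Definition mesh_angle (R : realType) (N : nat) : R := pi / N.+1%:R.

Section ModeAngles.
Variables (R : realType) (N : nat).
Hypothesis N2 : (2 <= N)%N.

Local Notation t := (mesh_angle R N).

Let tN : N.+1%:R * t = pi.
Proof. by rewrite /mesh_angle mulrC divfK // pnatr_eq0. Qed.

Let t_gt0 : 0 < t.
Proof. by rewrite /mesh_angle divr_gt0 ?pi_gt0. Qed.

Let t_lt (k : nat) : (k < N.+1)%N -> k%:R * t < pi.
Proof. by move=> kN; rewrite -tN ltr_pM2r // ltr_nat. Qed.

Lemma sine_mode1 : eigenpair (2 - 2 * cos t) (sine_mode N t).
Proof.
apply: sine_mode_eigenpair; first exact: ltnW.
  apply: lt0r_neq0; apply: sin_gt0_pi; rewrite t_gt0.
  by have := @t_lt 1 (ltnW N2); rewrite mul1r.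
by rewrite tN sinpi.
Qed.

Lemma sine_mode2 : eigenpair (2 - 2 * cos (2 * t)) (sine_mode N (2 * t)).
Proof.
apply: sine_mode_eigenpair; first exact: ltnW.
  by apply: lt0r_neq0; apply: sin_gt0_pi; rewrite mulr_gt0 // t_lt.
by rewrite mulrCA tN mulr_natl sin2pi.
Qed.

(* [pi - t = N * t] is the angle of the last mode. *)
Lemma sine_modeN : eigenpair (2 + 2 * cos t) (sine_mode N (pi - t)).
Proof.
have -> : 2 + 2 * cos t = 2 - 2 * cos (pi - t).
  by rewrite cosB cospi sinpi; ring.
apply: sine_mode_eigenpair; first exact: ltnW.
  apply: lt0r_neq0; rewrite sinB cospi sinpi mul0r sub0r mulN1r opprK.
  apply: sin_gt0_pi; rewrite t_gt0.
  by have := @t_lt 1 (ltnW N2); rewrite mul1r.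
have -> : N.+1%:R * (pi - t) = N%:R * pi :> R.
  by rewrite mulrBr tN -natr1; ring.
elim: (N) => [|n IHn]; first by rewrite mul0r sin0.
by rewrite -natr1 mulrDl mul1r sinD sinpi mulr0 IHn mul0r addr0.
Qed.

Lemma cos_mode1_gt0 : 0 < cos t.
Proof.
apply: cos_gt0_pihalf; apply/andP; split.
  by have := pi_gt0 R; have := t_gt0; lra.
by have := @t_lt 2 N2; lra.
Qed.

Lemma cos_mode2_gt0 : (4 <= N)%N -> 0 < cos (2 * t).
Proof.
move=> N4; apply: cos_gt0_pihalf; apply/andP; split.
  by have := pi_gt0 R; have := t_gt0; lra.
by have := @t_lt 4 N4; lra.
Qed.

Lemma cos_mode2_lt : cos (2 * t) < cos t.
Proof.
have := @t_lt 2 N2; have := pi_gt0 R; have := t_gt0 => ? ? ?.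
by rewrite ltr_cos ?in_itv /=; try (apply/andP; split); lra.
Qed.

End ModeAngles.

Lemma ex_task_expected_count_gt_omega (R : realType) (N : nat) : (2 <= N)%N ->
  forall eps M : R, 0 < eps -> 0 < M ->
    exists T : task_space R N,
      [/\ 0 < c1 T,
          (4 <= N)%N -> first_task_harder T
        & forall m : nat,
            unique_minimizer (expected_loss T m) (omega T m) /\
            M < expected_count T eps (omega T m)].
Proof.
move=> N2 eps M eps0 _; pose t := mesh_angle R N.
have cos0 : 0 < cos t := cos_mode1_gt0 _ N2.
have rho (z : R) : 1 - (2 - 2 * z) / 2 = z by field.
have rho' (z : R) : 1 - (2 + 2 * z) / 2 = - z by field.
have [N4|N4] := leqP 4 N.
  have cos20 : 0 < cos (2 * t) := cos_mode2_gt0 _ N4.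
  have lt2 : cos (2 * t) < cos t := cos_mode2_lt _ N2.
  have [||||T [E1 E2 c10 large]] := @ex_expected_count_gt _ _ _ _ _ _ eps M
    (sine_mode1 R N2) (sine_mode2 R N2); rewrite ?rho ?lt0r_neq0 //; first by lra.
  exists T; split=> // [_|m].
    by rewrite /first_task_harder E1 E2 !rho !gtr0_norm.
  split=> //; apply: omega_unique_minimizer => //.
  by rewrite E1 rho lt0r_neq0.
have [||||T [E1 E2 c10 large]] := @ex_expected_count_gt _ _ _ _ _ _ eps M
    (sine_mode1 R N2) (sine_modeN R N2); rewrite ?rho ?rho' ?oppr_eq0 ?lt0r_neq0 //.
  by move: cos0; rewrite /t; lra.
exists T; split=> // m; split=> //; apply: omega_unique_minimizer => //.
by rewrite E1 rho lt0r_neq0.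
Qed.

Theorem proposition2p2 (R : realType) (N : nat) :
  (forall T : task_space R N, 0 < c1 T -> first_task_harder T ->
    [/\ forall m : nat, unique_minimizer (expected_loss T m) (omega T m),
        omega T @ \oo --> (mu1 T)^-1
      & forall eps : R, 0 < eps ->
          exists m0 : nat, forall m1 m2 : nat, (m0 < m1)%N -> (m1 < m2)%N ->
            expected_count T eps (omega T m1)
              <= expected_count T eps (omega T m2)])
  /\
  ((2 <= N)%N -> forall eps M : R, 0 < eps -> 0 < M ->
    exists T : task_space R N,
      [/\ 0 < c1 T,
          (4 <= N)%N -> first_task_harder T
        & forall m : nat,
            unique_minimizer (expected_loss T m) (omega T m) /\
            M < expected_count T eps (omega T m)]).
Proof.
split; last exact: ex_task_expected_count_gt_omega.
move=> T c10 harder.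
have rho0 : 1 - mu1 T / 2 != 0 by rewrite -normr_gt0 (le_lt_trans _ harder).
split; first exact: omega_unique_minimizer.
- exact: omega_cvg.
- exact: expected_count_omega_le.
Qed.
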